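(* Consider the complex 3-dimensional Novikov algebras $D_1$, $D_2(\alpha)$ $(\alpha\in\mathbb{C})$ and $E_{1,1}(\alpha)$ $(\alpha\in\mathbb{C})$, $E_{2,1}$ given by the products listed in the context. For $A$ in the first list (type $D$) and $B$ in the second list (type $E_{\lambda=1}$), $B$ lies in $\partial O(A)$ if and only if $B$ is one of the algebras given for $A$ below: \begin{itemize} \item $A=D_1$: $E_{1,1}(-1)$, $E_{2,1}$; \item $A=D_2(\alpha)$ with $\alpha\neq-1$: $E_{1,1}(\alpha)$; \item $A=D_2(-1)$: $E_{1,1}(-1)$, $E_{2,1}$. \end{itemize}
   Context: A Novikov algebra over $\mathbb{C}$ is a complex vector space with a bilinear product satisfying $(x\cdot y)\cdot z-x\cdot(y\cdot z)=(y\cdot x)\cdot z-y\cdot(x\cdot z)$ and $(x\cdot y)\cdot z=(x\cdot z)\cdot y$ for all $x,y,z$. Fix a 3-dimensional complex vector space $V$ with basis $(e_1,e_2,e_3)$. The set of Novikov products on $V$, identified with their structure constants in $\mathbb{C}^{27}$, is an affine algebraic set, on which $GL_3(\mathbb{C})$ acts by $(g\circ\mu)(x,y)=g(\mu(g^{-1}x,g^{-1}y))$. For a 3-dimensional Novikov algebra $A$, $O(A)$ is the orbit of a structure representing $A$, $\overline{O(A)}$ its Zariski closure, and $\partial O(A)=\overline{O(A)}\setminus O(A)$; ''$B$ lies in $\partial O(A)$'' means that a structure representing $B$ lies in $\partial O(A)$. The algebras (basis $e_1,e_2,e_3$; products of basis vectors not listed are zero); they are pairwise non-isomorphic: $D_1$: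 $e_1e_1=-e_1+e_3$, $e_1e_3=e_2$, $e_2e_1=-e_2$, $e_3e_1=-e_3$. $D_2(\alpha)$: $e_1e_1=\alpha e_1$, $e_1e_2=(\alpha+1)e_2$, $e_1e_3=e_2+(\alpha+1)e_3$, $e_2e_1=\alpha e_2$, $e_3e_1=\alpha e_3$. $E_{1,1}(\alpha)$: $e_1e_1=\alpha e_1$, $e_1e_2=(\alpha+1)e_2$, $e_1e_3=(\alpha+1)e_3$, $e_2e_1=\alpha e_2$, $e_3e_1=\alpha e_3$. $E_{2,1}$: $e_1e_1=-e_1+e_2$, $e_2e_1=-e_2$, $e_3e_1=-e_3$. *)

(* Defs.v *)
From HB Require Import structures.
From mathcomp Require Import all_boot all_order all_algebra ring.
From mathcomp Require Import classical_sets reals complex mpoly.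

Set Implicit Arguments.
Unset Strict Implicit.
Unset Printing Implicit Defensive.

Import GRing.Theory.
Local Open Scope classical_set_scope.
Local Open Scope ring_scope.

Section ZariskiClosure.
Variables (K : fieldType) (I : finType).

(* The variables of a polynomial on K^I are numbered through enum_val. *)
Definition zariski_closure (S : set {ffun I -> K}) : set {ffun I -> K} :=
  [set c | forall p : {mpoly K[#|I|]},
     (forall s, S s -> p.@[fun k => s (enum_val k)] = 0) ->
     p.@[fun k => c (enum_val k)] = 0].

End ZariskiClosure.

Section Structures.
Variable K : fieldType.

Local Notation V := ('cV[K]_3).

Definition bvec (i : 'I_3) : V := delta_mx i 0.

(* c (i, j, k) is the coefficient of e_k in the product e_i e_j. *)
Definition structure_constants := {ffun 'I_3 * 'I_3 * 'I_3 -> K}.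

Definition mul (c : structure_constants) (x y : V) : V :=
  \col_k \sum_i \sum_j x i 0 * y j 0 * c (i, j, k).

Definition coords (mu : V -> V -> V) : structure_constants :=
  [ffun t => mu (bvec t.1.1) (bvec t.1.2) t.2 0].

(* [coords] and [mul] identify bilinear products with points of K^27. *)
Lemma mul_linearl c y : linear ((mul c)^~ y).
Proof.
move=> a x x'; apply/colP => k; rewrite !mxE mulr_sumr -big_split /=.
apply: eq_bigr => i _; rewrite mulr_sumr -big_split /=.
by apply: eq_bigr => j _; rewrite !mxE; ring.
Qed.

Lemma mul_linearr c x : linear (mul c x).
Proof.
move=> a y y'; apply/colP => k; rewrite !mxE mulr_sumr -big_split /=.
apply: eq_bigr => i _; rewrite mulr_sumr -big_split /=.
by apply: eq_bigr => j _; rewrite !mxE; ring.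
Qed.

Lemma mulK c : coords (mul c) = c.
Proof.
apply/ffunP => -[[i j] k]; rewrite !ffunE !mxE /=.
rewrite (bigD1 i) //= [X in _ + X]big1 => [|i' ni]; last first.
  by rewrite big1 // => j' _; rewrite !mxE (negPf ni) !mul0r.
rewrite (bigD1 j) //= [X in _ + X + _]big1 => [|j' nj]; last first.
  by rewrite !mxE (negPf nj) mulr0 mul0r.
by rewrite !mxE !eqxx !mul1r !addr0.
Qed.

Lemma coordsK (mu : V -> V -> V) :
  (forall y, linear (mu^~ y)) -> (forall x, linear (mu x)) ->
  forall x y, mul (coords mu) x y = mu x y.
Proof.
move=> muLl muLr x y.
pose Ll y := GRing.isLinear.Build K V V *:%R (mu^~ y) (muLl y).
pose Lr x := GRing.isLinear.Build K V V *:%R (mu x) (muLr x).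
pose ml y : {linear V -> V} := HB.pack (mu^~ y) (Ll y).
pose mr x : {linear V -> V} := HB.pack (mu x) (Lr x).
have dec (z : V) : z = \sum_i z i 0 *: bvec i.
  by rewrite {1}[z]matrix_sum_delta; apply: eq_bigr => i _; rewrite big_ord1.
have -> : mu x y = \sum_i \sum_j (x i 0 * y j 0) *: mu (bvec i) (bvec j).
  rewrite {1}[x]dec -[LHS]/(ml y _) linear_sum; apply: eq_bigr => i _.
  rewrite linearZ /= {1}[y]dec -[X in _ *: X]/(mr (bvec i) _) linear_sum.
  by rewrite scaler_sumr; apply: eq_bigr => j _; rewrite linearZ scalerA.
apply/colP => k; rewrite !mxE summxE; apply: eq_bigr => i _.
by rewrite summxE; apply: eq_bigr => j _; rewrite !mxE ffunE.
Qed.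

Definition novikov_identities (mu : V -> V -> V) : Prop :=
  (forall x y z,
     mu (mu x y) z - mu x (mu y z) = mu (mu y x) z - mu y (mu x z)) /\
  (forall x y z, mu (mu x y) z = mu (mu x z) y).

Record novikov := Novikov {
  constants :> structure_constants;
  constantsP : novikov_identities (mul constants) }.

Definition act (g : 'M[K]_3) (c : structure_constants) : structure_constants :=
  coords (fun x y => g *m mul c (invmx g *m x) (invmx g *m y)).

Lemma mul_act g c x y :
  mul (act g c) x y = g *m mul c (invmx g *m x) (invmx g *m y).
Proof.
rewrite coordsK // => z a u v.
  by rewrite mulmxDr -scalemxAr mul_linearl mulmxDr -scalemxAr.
by rewrite mulmxDr -scalemxAr mul_linearr mulmxDr -scalemxAr.
Qed.

Lemma act_novikov g c : g \in unitmx ->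
  novikov_identities (mul c) -> novikov_identities (mul (act g c)).
Proof.
move=> gU [lsym rcomm]; split=> x y z; rewrite !mul_act !mulKmx //.
  by rewrite -!mulmxBr lsym.
by rewrite rcomm.
Qed.

Definition orbit (A : novikov) : set structure_constants :=
  [set act g A | g in [set g : 'M[K]_3 | g \in unitmx]].

Definition orbit_boundary (A : novikov) : set structure_constants :=
  zariski_closure (orbit A) `\` orbit A.

(* The structures representing B are the elements of its orbit. *)
Definition lies_in_boundary (B A : novikov) : Prop :=
  exists2 c, orbit B c & orbit_boundary A c.

Definition of_table (t : 'I_3 -> 'I_3 -> V) : structure_constants :=
  [ffun u => t u.1.1 u.1.2 u.2 0].

Local Notation e1 := (bvec 0).
Local Notation e2 := (bvec 1).
Local Notation e3 := (bvec 2).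

(* Indices in the matches below start from 0: (0, 2) is the product e1 e3. *)
Definition D1_table (i j : 'I_3) : V :=
  match val i, val j with
  | 0%N, 0%N => - e1 + e3
  | 0%N, 2%N => e2
  | 1%N, 0%N => - e2
  | 2%N, 0%N => - e3
  | _, _ => 0
  end.

Definition D2_table (a : K) (i j : 'I_3) : V :=
  match val i, val j with
  | 0%N, 0%N => a *: e1
  | 0%N, 1%N => (a + 1) *: e2
  | 0%N, 2%N => e2 + (a + 1) *: e3
  | 1%N, 0%N => a *: e2
  | 2%N, 0%N => a *: e3
  | _, _ => 0
  end.

Definition E11_table (a : K) (i j : 'I_3) : V :=
  match val i, val j with
  | 0%N, 0%N => a *: e1
  | 0%N, 1%N => (a + 1) *: e2
  | 0%N, 2%N => (a + 1) *: e3
  | 1%N, 0%N => a *: e2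
  | 2%N, 0%N => a *: e3
  | _, _ => 0
  end.

Definition E21_table (i j : 'I_3) : V :=
  match val i, val j with
  | 0%N, 0%N => - e1 + e2
  | 1%N, 0%N => - e2
  | 2%N, 0%N => - e3
  | _, _ => 0
  end.

Local Definition col3 (a b c : K) : V := \col_k [:: a; b; c]`_k.

Lemma sum3E (F : 'I_3 -> K) : \sum_i F i = F 0 + F 1 + F 2.
Proof.
rewrite !big_ord_recr big_ord0 /= add0r.
by congr (F _ + F _ + F _); apply: val_inj.
Qed.

Ltac mul_by_table :=
  apply/colP => -[[|[|[|//]]] ?];
  rewrite !mxE !sum3E !ffunE /= !mxE /=; ring.

Lemma D1_mul x y : mul (of_table D1_table) x y =
  col3 (- (x 0 0 * y 0 0)) (x 0 0 * y 2 0 - x 1 0 * y 0 0)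
       (x 0 0 * y 0 0 - x 2 0 * y 0 0).
Proof. mul_by_table. Qed.

Lemma D2_mul a x y : mul (of_table (D2_table a)) x y =
  col3 (a * (x 0 0 * y 0 0))
       ((a + 1) * (x 0 0 * y 1 0) + x 0 0 * y 2 0 + a * (x 1 0 * y 0 0))
       ((a + 1) * (x 0 0 * y 2 0) + a * (x 2 0 * y 0 0)).
Proof. mul_by_table. Qed.

Lemma E11_mul a x y : mul (of_table (E11_table a)) x y =
  col3 (a * (x 0 0 * y 0 0))
       ((a + 1) * (x 0 0 * y 1 0) + a * (x 1 0 * y 0 0))
       ((a + 1) * (x 0 0 * y 2 0) + a * (x 2 0 * y 0 0)).
Proof. mul_by_table. Qed.

Lemma E21_mul x y : mul (of_table E21_table) x y =
  col3 (- (x 0 0 * y 0 0)) (x 0 0 * y 0 0 - x 1 0 * y 0 0)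
       (- (x 2 0 * y 0 0)).
Proof. mul_by_table. Qed.

Ltac novikov_by mulE :=
  split=> x y z; rewrite !mulE;
  apply/colP => -[[|[|[|//]]] ?]; rewrite !mxE /=; ring.

Lemma D1_novikov : novikov_identities (mul (of_table D1_table)).
Proof. novikov_by D1_mul. Qed.

Lemma D2_novikov a : novikov_identities (mul (of_table (D2_table a))).
Proof. novikov_by D2_mul. Qed.

Lemma E11_novikov a : novikov_identities (mul (of_table (E11_table a))).
Proof. novikov_by E11_mul. Qed.

Lemma E21_novikov : novikov_identities (mul (of_table E21_table)).
Proof. novikov_by E21_mul. Qed.

Definition D1 : novikov := Novikov D1_novikov.
Definition D2 (a : K) : novikov := Novikov (D2_novikov a).
Definition E11 (a : K) : novikov := Novikov (E11_novikov a).
Definition E21 : novikov := Novikov E21_novikov.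

Definition type_E1 (B : novikov) : Prop := (exists b, B = E11 b) \/ B = E21.

End Structures.

Arguments D1 {K}.
Arguments E21 {K}.

(* Main.v *)
From mathcomp Require Import all_boot all_order all_algebra.
From mathcomp Require Import reals complex.
From mathcomp Require Import ring mpoly classical_sets.
Require Import Defs.

Set Implicit Arguments.
Unset Strict Implicit.
Unset Printing Implicit Defensive.

Import GRing.Theory.
Local Open Scope ring_scope.

(** Let [f] be the first coordinate. All the algebras are given by a scalar [a]
    and a matrix [L] with [f L = 0], through [x y = a f(y) x + f(x) L y]
    ([matrix_product]), and an invertible [g] with [f g = f] replaces [L] by its
    conjugate [g L g^-1] ([act_matrix_product]). Three facts then suffice.

    Degenerations ([matrix_degeneration]): if [M + t D] is conjugate to [L] by
    such a [g] for every nonzero [t], the structures with matrix [M + t D] form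
    a line in the space of structure constants which lies in the orbit of [L]
    outside [t = 0]; a polynomial vanishing on that orbit then vanishes at
    [t = 0]. For each required pair the matrix of [B] is such a limit: the
    Jordan block of [D2 a] degenerates to a scalar block, the nilpotent
    matrix of rank two of [D1] degenerates to rank one or zero, and the
    nilpotent matrices of rank one of [D2 (-1)] and [E21] differ only in the
    position of their kernel with respect to that of [f].

    Obstruction ([trace_degeneration]): the right multiplication by [x] has
    trace [3 a f(x)] and the left one has trace [(a + tr L) f(x)], so
    [(a + tr L) tr R_x = 3 a tr L_x] on the orbit. This relation is linear in
    the structure constants, so it persists on the closure. A limit with data
    [b], [M] therefore satisfies [b tr L = a tr M], which excludes all other
    pairs.

    Orbits ([boundary_type_E1]): in type E the commutator of [x] and [y] is
    [f(x) y - f(y) x], while in type D the commutator of the first and third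
    basis vectors leaves their span. The orbits are thus disjoint, so a point of
    the closure representing a type E algebra is in the boundary. *)

(** * Zariski closure *)

(** Restricting a polynomial to the line gives a univariate polynomial in [t];
    if it vanishes for [t != 0] it has infinitely many roots, namely the
    nonzero natural numbers, and so it also vanishes at [t = 0]. *)
Lemma zariski_closure_line (K : numFieldType) (I : finType)
    (S : set {ffun I -> K}) (c d : {ffun I -> K}) :
  (forall t, t != 0 -> S [ffun u => c u + t * d u]) -> zariski_closure S c.
Proof.
move=> Sline p p0.
pose q : {poly K} := mmap polyC
  (fun k => (c (enum_val k))%:P + (d (enum_val k))%:P * 'X) p.
have qE t : q.[t] = p.@[fun k => c (enum_val k) + t * d (enum_val k)].
  rewrite /q /mmap /meval /mmap horner_sum; apply: eq_bigr => m _.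
  rewrite hornerCM /mmap1 horner_prod; congr (_ * _).
  by apply: eq_bigr => k _; rewrite !(hornerE, horner_exp) mulrC.
have q0 : q = 0.
  pose rs : seq K := [seq n.+1%:R | n <- iota 0 (size q)].
  apply: (@roots_geq_poly_eq0 _ q rs); last by rewrite size_map size_iota.
    apply/allP => _ /mapP[n _ ->]; rewrite rootE qE.
    have n0 : n.+1%:R != 0 :> K by rewrite Num.Theory.pnatr_eq0.
    rewrite -(p0 _ (Sline _ n0)); apply/eqP/meval_eq => k.
    by rewrite ffunE.
  rewrite map_inj_uniq ?iota_uniq // => m n /eqP.
  by rewrite Num.Theory.eqr_nat eqSS => /eqP.
have <- : q.[0] = 0 by rewrite q0 horner0.
by rewrite qE; apply: meval_eq => k; rewrite mul0r addr0.
Qed.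

(** * Coordinates *)

Lemma forall_ord3 (P : 'I_3 -> Prop) : P 0 -> P 1 -> P 2 -> forall i, P i.
Proof.
by move=> P0 P1 P2 [[|[|[|//]]] lti];
  [move: P0 | move: P1 | move: P2]; congr P; apply: val_inj.
Qed.

Ltac entrywise :=
  (apply/colP; apply: forall_ord3) ||
  (apply/matrixP; apply: forall_ord3; apply: forall_ord3);
  rewrite !mxE ?sum3E !mxE /=.

(** * Change of basis and orbits *)

Section AlgebraicInvariants.
Variable K : fieldType.
Implicit Types (c : structure_constants K) (g L M : 'M[K]_3) (a : K).

Lemma eq_coords (mu nu : 'cV[K]_3 -> 'cV[K]_3 -> 'cV[K]_3) :
  mu =2 nu -> coords mu = coords nu.
Proof. by move=> munu; apply/ffunP => u; rewrite !ffunE munu. Qed.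

Lemma act_morphism g c c' : g \in unitmx ->
    (forall x y, g *m mul c x y = mul c' (g *m x) (g *m y)) ->
  act g c = c'.
Proof.
move=> gU gM; rewrite -[RHS]mulK; apply: eq_coords => x y.
by rewrite gM !mulKVmx.
Qed.

Lemma orbit_refl (A : novikov K) : orbit A A.
Proof.
exists 1%:M; first exact: unitmx1.
by apply: act_morphism (unitmx1 _ _) _ => x y; rewrite !mul1mx.
Qed.

(** * An invariant separating the two types *)

(** The function [phi] is left arbitrary, so that no basis occurs in this
    condition and it passes along isomorphisms by composition. *)
Definition planar_commutator c := exists phi : 'cV[K]_3 -> K,
  forall x y, mul c x y - mul c y x = phi x *: y - phi y *: x.

Lemma planar_commutator_act g c : g \in unitmx ->
  planar_commutator (act g c) -> planar_commutator c.
Proof.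
move=> gU [phi phiP]; exists (fun x => phi (g *m x)) => x y.
apply: (can_inj (mulKmx gU)); rewrite !mulmxBr -!scalemxAr -phiP !mul_act.
by rewrite !mulKmx.
Qed.

(** * Traces of the multiplication operators *)

Definition left_mx c (x : 'cV[K]_3) : 'M[K]_3 :=
  \matrix_(k, j) \sum_i x i 0 * c (i, j, k).

Definition right_mx c (y : 'cV[K]_3) : 'M[K]_3 :=
  \matrix_(k, i) \sum_j y j 0 * c (i, j, k).

Lemma left_mxE c x y : left_mx c x *m y = mul c x y.
Proof.
apply/colP => k; rewrite !mxE exchange_big /=; apply: eq_bigr => j _.
by rewrite mxE mulr_suml; apply: eq_bigr => i _; ring.
Qed.

Lemma right_mxE c x y : right_mx c y *m x = mul c x y.
Proof.
apply/colP => k; rewrite !mxE; apply: eq_bigr => i _.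
by rewrite mxE mulr_suml; apply: eq_bigr => j _; ring.
Qed.

Lemma eq_mulmx_cV (A B : 'M[K]_3) :
  (forall y : 'cV[K]_3, A *m y = B *m y) -> A = B.
Proof.
move=> AB; apply/matrixP => i j.
by have /colP/(_ i) := AB (delta_mx j 0); rewrite -!colE !mxE.
Qed.

Lemma left_mx_act g c x :
  left_mx (act g c) x = g *m left_mx c (invmx g *m x) *m invmx g.
Proof.
by apply: eq_mulmx_cV => y; rewrite -!mulmxA !left_mxE mul_act.
Qed.

Lemma right_mx_act g c y :
  right_mx (act g c) y = g *m right_mx c (invmx g *m y) *m invmx g.
Proof.
by apply: eq_mulmx_cV => x; rewrite -!mulmxA !right_mxE mul_act.
Qed.

(** Both sides are linear in the structure constants, so such a relation defines
    a Zariski closed set. *)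
Definition trace_relation (al be : K) c :=
  forall x, al * \tr (right_mx c x) = be * \tr (left_mx c x).

Lemma trace_relation_act al be g c : g \in unitmx ->
  trace_relation al be (act g c) <-> trace_relation al be c.
Proof.
have trJ (A : 'M[K]_3) : g \in unitmx -> \tr (g *m A *m invmx g) = \tr A.
  by move=> gU; rewrite mxtrace_mulC mulKmx.
move=> gU; split=> rel x.
  by have := rel (g *m x); rewrite left_mx_act right_mx_act !trJ // mulKmx.
by rewrite left_mx_act right_mx_act !trJ.
Qed.

Lemma trace_relation_closure al be (S : set (structure_constants K)) :
    (forall c, S c -> trace_relation al be c) ->
  forall c, zariski_closure S c -> trace_relation al be c.
Proof.
move=> relS c Sc x.
pose T : finType := ('I_3 * 'I_3 * 'I_3)%type.
pose X (u : T) : {mpoly K[#|T|]} := 'X_(enum_rank u).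
pose p : {mpoly K[#|T|]} :=
  \sum_k \sum_i x i 0 *: (al *: X (k, i, k) - be *: X (i, k, k)).
have pE (s : structure_constants K) : p.@[fun k => s (enum_val k)] =
    al * \tr (right_mx s x) - be * \tr (left_mx s x).
  rewrite /p /mxtrace raddf_sum !mulr_sumr -sumrB; apply: eq_bigr => k _.
  rewrite raddf_sum !mxE !mulr_sumr -sumrB; apply: eq_bigr => i _ /=.
  by rewrite mevalZ mevalB !mevalZ !mevalXU !enum_rankK; ring.
apply/eqP; rewrite -subr_eq0 -pE Sc // => s Ss.
by rewrite pE (relS s Ss) subrr.
Qed.

(** * Products built from a matrix *)

Definition matrix_product a L : structure_constants K :=
  coords (fun x y => (a * y 0 0) *: x + x 0 0 *: (L *m y)).

Lemma mul_matrix_product a L x y :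
  mul (matrix_product a L) x y = (a * y 0 0) *: x + x 0 0 *: (L *m y).
Proof.
apply: coordsK => [z b u v|z b u v].
  by apply/colP => k; rewrite !mxE; ring.
by rewrite mulmxDr -scalemxAr; apply/colP => k; rewrite !mxE; ring.
Qed.

Lemma matrix_productP a L c :
    (forall x y, mul c x y = (a * y 0 0) *: x + x 0 0 *: (L *m y)) ->
  c = matrix_product a L.
Proof. by move=> cE; rewrite -[LHS]mulK; apply: eq_coords. Qed.

Lemma act_matrix_product a L M g : g \in unitmx ->
    (forall x : 'cV[K]_3, (g *m x) 0 0 = x 0 0) -> g *m L = M *m g ->
  act g (matrix_product a L) = matrix_product a M.
Proof.
move=> gU gf gL; apply: act_morphism => // x y.
by rewrite !mul_matrix_product !gf mulmxDr -!scalemxAr !mulmxA gL.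
Qed.

(** The part of the commutator not visibly in the span of [x] and [y] is
    [f(x) f(y) w], which is symmetric and cancels. *)
Lemma planar_commutator_matrix_product a L (w : 'cV[K]_3) :
    (forall y : 'cV[K]_3, L *m y = (a + 1) *: y + y 0 0 *: w) ->
  planar_commutator (matrix_product a L).
Proof.
move=> Lw; exists (fun x => x 0 0) => x y.
by rewrite !mul_matrix_product !Lw; apply/colP => k; rewrite !mxE; ring.
Qed.

(** Let [e] be the first basis vector and [u] the one of index [j]. The
    coordinate of index [i] of [e u - u e] is [L i j], and it vanishes on the
    span of [e] and [u]. *)
Lemma planar_commutator_entry a L i j : i != 0 -> j != 0 -> i != j ->
  planar_commutator (matrix_product a L) -> L i j = 0.
Proof.
move=> i0 j0 ij [phi /(_ (bvec K 0) (bvec K j))/colP/(_ i)].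
rewrite !mul_matrix_product -!colE !mxE (negPf i0) (negPf ij) !(eq_sym 0 j).
by rewrite (negPf j0) /= !(mulr0, mul0r, addr0, add0r, mul1r, oppr0, subr0).
Qed.

(** The right multiplication by [x] is a scalar matrix plus the rank one matrix
    [(L x) f], where [f] is the first coordinate. *)
Lemma trace_right_matrix_product a L x :
  \tr (right_mx (matrix_product a L) x) = 3%:R * a * x 0 0 + (L *m x) 0 0.
Proof.
have -> : right_mx (matrix_product a L) x =
    (a * x 0 0)%:M + (L *m x) *m delta_mx 0 0.
  apply: eq_mulmx_cV => y; rewrite right_mxE mul_matrix_product mulmxDl.
  rewrite mul_scalar_mx -!mulmxA -rowE; congr (_ + _).
  by rewrite [row 0 y]mx11_scalar mul_mx_scalar -scalemxAr mxE.
rewrite mxtraceD mxtrace_scalar mxtrace_mulC -rowE trace_mx11 mxE.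
by rewrite mulr_natl mulrnAl.
Qed.

(** The left multiplication by [x] is the rank one matrix [a x f] plus
    [f(x) L], where [f] is the first coordinate. *)
Lemma trace_left_matrix_product a L x :
  \tr (left_mx (matrix_product a L) x) = (a + \tr L) * x 0 0.
Proof.
have -> : left_mx (matrix_product a L) x =
    a *: (x *m delta_mx 0 0) + x 0 0 *: L.
  apply: eq_mulmx_cV => y; rewrite left_mxE mul_matrix_product mulmxDl.
  rewrite -!scalemxAl -mulmxA -rowE; congr (_ + _).
  by rewrite [row 0 y]mx11_scalar mul_mx_scalar mxE scalerA.
rewrite mxtraceD !linearZ /= mxtrace_mulC -rowE trace_mx11 mxE mulrDl.
by rewrite [\tr L * _]mulrC.
Qed.

(** * The algebras *)

Definition D1_mx : 'M[K]_3 := delta_mx 2 0 + delta_mx 1 2.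
Definition E11_mx a : 'M[K]_3 := (a + 1) *: (delta_mx 1 1 + delta_mx 2 2).
Definition D2_mx a : 'M[K]_3 := E11_mx a + delta_mx 1 2.
Definition E21_mx : 'M[K]_3 := delta_mx 1 0.

Lemma D1E : D1 = matrix_product (-1) D1_mx :> structure_constants K.
Proof. by apply: matrix_productP => x y; rewrite D1_mul; entrywise; ring. Qed.

Lemma D2E a : D2 a = matrix_product a (D2_mx a) :> structure_constants K.
Proof. by apply: matrix_productP => x y; rewrite D2_mul; entrywise; ring. Qed.

Lemma E11E a : E11 a = matrix_product a (E11_mx a) :> structure_constants K.
Proof. by apply: matrix_productP => x y; rewrite E11_mul; entrywise; ring. Qed.

Lemma E21E : E21 = matrix_product (-1) E21_mx :> structure_constants K.
Proof. by apply: matrix_productP => x y; rewrite E21_mul; entrywise; ring. Qed.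

Lemma trace_E11_mx a : \tr (E11_mx a) = 2%:R * (a + 1).
Proof. by rewrite /mxtrace sum3E !mxE /=; ring. Qed.

Lemma trace_D1_mx : \tr D1_mx = 0.
Proof. by rewrite /mxtrace sum3E !mxE /=; ring. Qed.

Lemma trace_D2_mx a : \tr (D2_mx a) = 2%:R * (a + 1).
Proof. by rewrite mxtraceD trace_E11_mx /mxtrace sum3E !mxE /=; ring. Qed.

Lemma trace_E21_mx : \tr E21_mx = 0.
Proof. by rewrite /mxtrace sum3E !mxE /=; ring. Qed.

Lemma planar_commutator_type_E1 (B : novikov K) :
  type_E1 B -> planar_commutator B.
Proof.
case=> [[b ->]|->].
  rewrite E11E; apply: (@planar_commutator_matrix_product _ _
    (- (b + 1) *: delta_mx 0 0)) => y; entrywise; ring.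
rewrite E21E; apply: (@planar_commutator_matrix_product _ _ (delta_mx 1 0)) => y.
entrywise; ring.
Qed.

Lemma D1_not_planar : ~ planar_commutator (@D1 K).
Proof.
rewrite D1E => /(@planar_commutator_entry _ _ 1 2 isT isT isT)/eqP.
by rewrite !mxE /= add0r oner_eq0.
Qed.

Lemma D2_not_planar a : ~ planar_commutator (D2 a).
Proof.
rewrite D2E => /(@planar_commutator_entry _ _ 1 2 isT isT isT)/eqP.
by rewrite !mxE /= addr0 mulr0 add0r oner_eq0.
Qed.

End AlgebraicInvariants.

(** * Degenerations *)

Section Degenerations.
Variable K : numFieldType.
Implicit Types (A B : novikov K) (L M D : 'M[K]_3) (a b : K).

(** [matrix_product a M] is affine in [M], so conjugates [M + t D] of [L] that
    tend to [M] give a line of structure constants. *)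
Lemma matrix_degeneration A B a L M D :
    A = matrix_product a L :> structure_constants K ->
    B = matrix_product a M :> structure_constants K ->
    (forall t, t != 0 -> exists2 g, g \in unitmx &
       (forall x : 'cV[K]_3, (g *m x) 0 0 = x 0 0) /\
       g *m L = (M + t *: D) *m g) ->
  zariski_closure (orbit A) (B : structure_constants K).
Proof.
move=> AE BE conj; rewrite BE.
apply: (zariski_closure_line (d := matrix_product 0 D)) => t t0.
have [g gU [gf gL]] := conj t t0; exists g => //.
rewrite AE (act_matrix_product a gU gf gL); apply/ffunP => -[[i j] k].
rewrite !ffunE /= mulmxDl -scalemxAl !mxE; ring.
Qed.

(** Since [L] has a zero first row, the traces of right and left multiplication
    by [x] on [A] are [3 a] and [a + \tr L] times the first coordinate of [x].
    Eliminating that coordinate gives a trace relation with coefficients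
    [a + \tr L] and [3 a] on the orbit of [A], hence at [B]. *)
Lemma trace_degeneration A B a b L M c :
    A = matrix_product a L :> structure_constants K ->
    B = matrix_product b M :> structure_constants K ->
    row 0 L = 0 -> row 0 M = 0 ->
    orbit B c -> zariski_closure (orbit A) c ->
  b * \tr L = a * \tr M.
Proof.
move=> AE BE L0 M0 [h hU <-].
have row0 N (x : 'cV[K]_3) : row 0 N = 0 -> (N *m x) 0 0 = 0.
  move=> N0; transitivity ((row 0 (N *m x)) 0 0); first by rewrite [RHS]mxE.
  by rewrite row_mul N0 mul0mx mxE.
have relA c' : orbit A c' -> trace_relation (a + \tr L) (3%:R * a) c'.
  case=> g gU <-; apply/trace_relation_act => // x.
  rewrite AE trace_right_matrix_product trace_left_matrix_product row0 //; ring.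
move=> /(trace_relation_closure relA)/(trace_relation_act _ _ _ hU).
move=> /(_ (delta_mx 0 0)).
rewrite BE trace_right_matrix_product trace_left_matrix_product row0 //.
rewrite !mxE /= => rel.
apply: (mulfI (x := 3%:R)); first by rewrite Num.Theory.pnatr_eq0.
apply/eqP; rewrite -subr_eq0; apply/eqP.
move/eqP: rel; rewrite -subr_eq0 => /eqP <-; ring.
Qed.

Lemma boundary_type_E1 A B : type_E1 B -> ~ planar_commutator A ->
  zariski_closure (orbit A) (B : structure_constants K) ->
  lies_in_boundary B A.
Proof.
move=> BE1 nA clB; exists (B : structure_constants K); first exact: orbit_refl.
split=> // -[g gU gAB]; apply: nA; apply: (planar_commutator_act gU).
by rewrite gAB; apply: planar_commutator_type_E1.
Qed.

Lemma row0_E11_mx a : row 0 (E11_mx a) = 0.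
Proof. by apply/rowP => j; rewrite !mxE /=; ring. Qed.

Lemma row0_D1_mx : row 0 (D1_mx K) = 0.
Proof. by apply/rowP => j; rewrite !mxE /=; ring. Qed.

Lemma row0_D2_mx a : row 0 (D2_mx a) = 0.
Proof. by apply/rowP => j; rewrite !mxE /=; ring. Qed.

Lemma row0_E21_mx : row 0 (E21_mx K) = 0.
Proof. by apply/rowP => j; rewrite !mxE /=; ring. Qed.

(** Rescaling the second basis vector by [t] multiplies the off-diagonal entry
    of the Jordan block by [t]. *)
Lemma E11_in_closure_D2 a :
  zariski_closure (orbit (D2 a)) (E11 a : structure_constants K).
Proof.
apply: (matrix_degeneration (D := delta_mx 1 2) (D2E a) (E11E a)) => t t0.
pose g s : 'M[K]_3 := delta_mx 0 0 + s *: delta_mx 1 1 + delta_mx 2 2.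
exists (g t).
  by apply: (proj1 (mulmx1_unit (B := g t^-1) _)); entrywise; field.
split; first by move=> x; rewrite !mxE sum3E !mxE /=; ring.
by entrywise; ring.
Qed.

(** The matrix of [D1] is the nilpotent chain [e_1 -> e_3 -> e_2 -> 0]. Giving
    its successive vectors the weights [1], [t], [t^2] conjugates it to [t]
    times itself. *)
Lemma E11_in_closure_D1 :
  zariski_closure (orbit D1) (E11 (-1) : structure_constants K).
Proof.
apply: (matrix_degeneration (D := D1_mx K) (D1E K) (E11E (-1))) => t t0.
pose g s : 'M[K]_3 := delta_mx 0 0 + s ^+ 2 *: delta_mx 1 1 + s *: delta_mx 2 2.
exists (g t).
  by apply: (proj1 (mulmx1_unit (B := g t^-1) _)); entrywise; field.
split; first by move=> x; rewrite !mxE sum3E !mxE /=; ring.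
by entrywise; ring.
Qed.

(** Here the chain of [D1] is relabelled and rescaled into
    [e_1 -> e_2 -> t e_3 -> 0], whose last arrow disappears at [t = 0]. *)
Lemma E21_in_closure_D1 :
  zariski_closure (orbit D1) (E21 : structure_constants K).
Proof.
apply: (matrix_degeneration (D := delta_mx 2 1) (D1E K) (E21E K)) => t t0.
exists (delta_mx 0 0 + delta_mx 1 2 + t *: delta_mx 2 1).
  apply: (proj1 (mulmx1_unit
    (B := delta_mx 0 0 + t^-1 *: delta_mx 1 2 + delta_mx 2 1) _)).
  by entrywise; field.
split; first by move=> x; rewrite !mxE sum3E !mxE /=; ring.
by entrywise; ring.
Qed.

(** For [a = -1] the matrix of [D2] sends [e_3] to [e_2] and kills [e_1], [e_2],
    while that of [E21] sends [e_1] to [e_2] and kills [e_2], [e_3]. The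
    family sends [e_1] to [e_2] and [e_3] to [t e_2]: its kernel contains
    [e_1 - t^-1 e_3], which [g] takes as the image of [e_1]. *)
Lemma E21_in_closure_D2 :
  zariski_closure (orbit (D2 (-1))) (E21 : structure_constants K).
Proof.
apply: (matrix_degeneration (D := delta_mx 1 2) (D2E (-1)) (E21E K)) => t t0.
exists (1%:M + (t^-1 - 1) *: delta_mx 2 2 - t^-1 *: delta_mx 2 0).
  apply: (proj1 (mulmx1_unit
    (B := 1%:M + (t - 1) *: delta_mx 2 2 + delta_mx 2 0) _)).
  by entrywise; field.
split; first by move=> x; rewrite !mxE sum3E !mxE /=; ring.
by entrywise; field.
Qed.

End Degenerations.

Theorem proposition4p12 (R : realType) :
  (forall B : novikov R[i], type_E1 B ->
     (lies_in_boundary B D1 <-> B = E11 (-1) \/ B = E21)) /\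
  (forall (a : R[i]) (B : novikov R[i]), a <> -1 -> type_E1 B ->
     (lies_in_boundary B (D2 a) <-> B = E11 a)) /\
  (forall B : novikov R[i], type_E1 B ->
     (lies_in_boundary B (D2 (-1)) <-> B = E11 (-1) \/ B = E21)).
Proof.
have two : 2%:R != 0 :> R[i] by rewrite Num.Theory.pnatr_eq0.
have D1_E11 (b : R[i]) : lies_in_boundary (E11 b) D1 -> b = -1.
  case=> c Bc [Ac _].
  have := trace_degeneration (D1E _) (E11E b) (row0_D1_mx _) (row0_E11_mx b)
            Bc Ac.
  rewrite trace_D1_mx trace_E11_mx mulr0 => rel.
  apply/eqP; rewrite -addr_eq0; apply/eqP; apply: (mulfI two).
  by rewrite mulr0; apply/eqP; rewrite -oppr_eq0 -mulN1r -rel.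
have D2_E11 (a b : R[i]) : lies_in_boundary (E11 b) (D2 a) -> b = a.
  case=> c Bc [Ac _].
  have := trace_degeneration (D2E a) (E11E b) (row0_D2_mx a) (row0_E11_mx b)
            Bc Ac.
  rewrite trace_D2_mx trace_E11_mx => /eqP; rewrite -subr_eq0 => /eqP rel.
  apply/eqP; rewrite -subr_eq0; apply/eqP; apply: (mulfI two).
  by rewrite mulr0 -rel; ring.
have D2_E21 (a : R[i]) : lies_in_boundary E21 (D2 a) -> a = -1.
  case=> c Bc [Ac _].
  have := trace_degeneration (D2E a) (E21E _) (row0_D2_mx a) (row0_E21_mx _)
            Bc Ac.
  rewrite trace_D2_mx trace_E21_mx mulr0 => /eqP.
  by rewrite mulN1r oppr_eq0 mulf_eq0 (negPf two) addr_eq0 => /eqP.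
have E11_type (b : R[i]) : type_E1 (E11 b) by left; exists b.
have E21_type : type_E1 (E21 : novikov R[i]) by right.
split=> [B BE1|]; last split=> [a B a1 BE1|B BE1].
- split=> [|[]->].
  + by case: BE1 => [[b ->] /D1_E11 ->|->]; [left|right].
  + exact: (boundary_type_E1 (E11_type _) (@D1_not_planar _)
      (@E11_in_closure_D1 _)).
  + exact: (boundary_type_E1 E21_type (@D1_not_planar _)
      (@E21_in_closure_D1 _)).
- split=> [|->]; last first.
    exact: (boundary_type_E1 (E11_type _) (@D2_not_planar _ a)
      (@E11_in_closure_D2 _ a)).
  by case: BE1 => [[b ->] /D2_E11 ->|-> /D2_E21].
- split=> [|[]->].
  + by case: BE1 => [[b ->] /D2_E11 ->|->]; [left|right].
  + exact: (boundary_type_E1 (E11_type _) (@D2_not_planar _ _)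
      (@E11_in_closure_D2 _ _)).
  + exact: (boundary_type_E1 E21_type (@D2_not_planar _ _)
      (@E21_in_closure_D2 _)).
Qed.
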